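(* Let $q\in\mathbb{C}^{\times}$ not be a root of unity, and let $\mathcal{U}_q(\mathfrak{sp}_4)$ (which is also $\mathcal{U}_q(\mathfrak{so}_5)$, since $\mathfrak{sp}_4\cong\mathfrak{so}_5$) be the algebra with generators $e_i,f_i,k_i^{\pm1}$ ($i=1,2$) and elements $k_{(a,b)}$ described in the context. Then the element $C\in\mathcal{U}_q(\mathfrak{sp}_4)$ defined by \begin{align*} C={}& q^{-2}(q-q^{-1})^2 \left( (1-q^2)f_1f_2f_1f_2 + (q^4-q^{-2})f_2f_1^2f_2 + (1-q^2)f_2f_1f_2f_1 + (1-q^2)f_1f_2^2f_1 \right) k_{(0,0)}\\ &\quad\times\left( (1-q^2)e_1e_2e_1e_2 + (q^4-q^{-2})e_2e_1^2e_2 + (1-q^2)e_2e_1e_2e_1 + (1-q^2)e_1e_2^2e_1 \right)\\ &+(q-q^{-1})^4 f_1f_1k_{(0,0)}e_1e_1\\ &+(q-q^{-1})^2\left((1+q^2)f_1f_2f_1-f_2f_1f_1-q^2f_1f_1f_2\right)k_{(0,2)}\left((1+q^2)e_1e_2e_1-e_1e_1e_2-q^2e_2e_1e_1\right)\\ &+(q-q^{-1})^2(q+q^{-1})\left(q^2f_1f_2-f_2f_1\right)k_{(1,1)}\left(q^2e_2e_1-e_1e_2\right)\\ &+(q^2-q^{-2})^2q^4 f_2k_{(2,0)}e_2\\ &+q^{-4}(q-q^{-1})^2\left((1+q^2)f_1f_2f_1-f_1f_1f_2-q^2f_2f_1f_1\right)k_{(0,-2)}\left((1+q^2)e_1e_2e_1-e_2e_1e_1-q^2e_1e_1e_2\right)\\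 &+q^{-4}(q-q^{-1})^2(q+q^{-1})\left(q^2f_2f_1-f_1f_2\right)k_{(-1,-1)}\left(q^2e_1e_2-e_2e_1\right)\\ &+q^{-4}(q^2-q^{-2})^2 f_2k_{(-2,0)}e_2\\ &+(q-q^{-1})^2(q+q^{-1})f_1k_{(-1,1)}e_1+(q-q^{-1})^2(q+q^{-1})f_1k_{(1,-1)}e_1\\ &+q^6k_{(2,2)}+q^{-6}k_{(-2,-2)}+q^2k_{(2,-2)}+q^{-2}k_{(-2,2)}+k_{(0,0)} \end{align*} is central in $\mathcal{U}_q(\mathfrak{sp}_4)$.
   Context: Let $\alpha_1=(1,-1)$ and $\alpha_2=(0,2)$ in $\mathbb{R}^2$ (the simple roots of $\mathfrak{sp}_4$), and let $(\cdot,\cdot)$ be the Euclidean inner product on $\mathbb{R}^2$, so $(\alpha_1,\alpha_1)=2$, $(\alpha_1,\alpha_2)=-2$, $(\alpha_2,\alpha_2)=4$. Put $q_1=q$, $q_2=q^2$. $\mathcal{U}_q(\mathfrak{sp}_4)$ is the unital associative $\mathbb{C}$-algebra generated by $e_i,f_i,k_i,k_i^{-1}$ ($i=1,2$), where $k_i^{-1}$ is the inverse of $k_i$, subject to the following relations for $1\le i,j\le 2$: $$[e_i,f_j]=\delta_{ij}\frac{k_i-k_i^{-1}}{q_i-q_i^{-1}},\qquad [k_i,k_j]=0,$$ $$k_ie_j=q^{(\alpha_i,\alpha_j)}e_jk_i,\qquad k_if_j=q^{-(\alpha_i,\alpha_j)}f_jk_i,$$ and the Serre relations $$e_2^2e_1-(q^2+q^{-2})e_2e_1e_2+e_1e_2^2=0,$$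 $$e_1^3e_2-(q^2+1+q^{-2})e_1^2e_2e_1+(q^2+1+q^{-2})e_1e_2e_1^2-e_2e_1^3=0,$$ $$f_2^2f_1-(q^2+q^{-2})f_2f_1f_2+f_1f_2^2=0,$$ $$f_1^3f_2-(q^2+1+q^{-2})f_1^2f_2f_1+(q^2+1+q^{-2})f_1f_2f_1^2-f_2f_1^3=0.$$ The root lattice is $\mathbb{Z}\alpha_1+\mathbb{Z}\alpha_2=\{(a,b)\in\mathbb{Z}^2: a+b\in2\mathbb{Z}\}$. For $(a,b)=m\alpha_1+n\alpha_2$ in the root lattice, $k_{(a,b)}:=k_1^mk_2^n$, i.e. $k_{(a,b)}=k_1^{a}k_2^{(a+b)/2}$. In particular $k_{(0,0)}=1$, $k_{(1,-1)}=k_1$, $k_{(0,2)}=k_2$. *)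

(* Defs.v *)
From HB Require Import structures.
From mathcomp Require Import all_boot all_order all_algebra.
From mathcomp Require Import boolp.
From mathcomp.multinomials Require Import monalg.

Set Implicit Arguments.
Unset Strict Implicit.
Unset Printing Implicit Defensive.

Import GRing.Theory.

Local Open Scope ring_scope.
Local Open Scope quotient_scope.

(* Indices are shifted: e_1 is [gen_e 0], e_2 is [gen_e 1], and so on.
   [gen_kV i] is the generator k_i^-1. *)
Inductive gen : Type :=
  | gen_e of 'I_2
  | gen_f of 'I_2
  | gen_k of 'I_2
  | gen_kV of 'I_2.

Definition gen_code (g : gen) : ('I_2 + 'I_2) + ('I_2 + 'I_2) :=
  match g with
  | gen_e i => inl (inl i)
  | gen_f i => inl (inr i)
  | gen_k i => inr (inl i)
  | gen_kV i => inr (inr i)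
  end.

Definition gen_decode (c : ('I_2 + 'I_2) + ('I_2 + 'I_2)) : gen :=
  match c with
  | inl (inl i) => gen_e i
  | inl (inr i) => gen_f i
  | inr (inl i) => gen_k i
  | inr (inr i) => gen_kV i
  end.

Lemma gen_codeK : cancel gen_code gen_decode.
Proof. by do 2?case. Qed.

HB.instance Definition _ := Choice.copy gen (can_type gen_codeK).

Definition simple_root (i : 'I_2) : int * int :=
  if i == 0 then (1, -1) else (0, 2).

Definition inner (u v : int * int) : int := u.1 * v.1 + u.2 * v.2.

Section Relations.
Variables (F : fieldType) (q : F).

Definition qi (i : 'I_2) : F := if i == 0 then q else q ^+ 2.

(* The defining relations u = v of U_q(sp_4), imposed on families of elements
   e i, f i, k i, kV i of an arbitrary F-algebra. *)
Section InAlgebra.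
Variables (A : lalgType F) (e f k kV : 'I_2 -> A).
Local Notation e1 := (e 0).
Local Notation e2 := (e 1).
Local Notation f1 := (f 0).
Local Notation f2 := (f 1).

Inductive uq_rel : A -> A -> Prop :=
  | uq_kkV i : uq_rel (k i * kV i) 1
  | uq_kVk i : uq_rel (kV i * k i) 1
  | uq_ef i j : uq_rel (e i * f j - f j * e i)
      (if i == j then (qi i - (qi i)^-1)^-1 *: (k i - kV i) else 0)
  | uq_kk i j : uq_rel (k i * k j - k j * k i) 0
  | uq_ke i j : uq_rel (k i * e j)
      (q ^ inner (simple_root i) (simple_root j) *: (e j * k i))
  | uq_kf i j : uq_rel (k i * f j)
      (q ^ (- inner (simple_root i) (simple_root j)) *: (f j * k i))
  | uq_serre_e21 : uq_rel
      (e2 ^+ 2 * e1 - (q ^+ 2 + q ^- 2) *: (e2 * e1 * e2) + e1 * e2 ^+ 2) 0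
  | uq_serre_e12 : uq_rel
      (e1 ^+ 3 * e2 - (q ^+ 2 + 1 + q ^- 2) *: (e1 ^+ 2 * e2 * e1)
       + (q ^+ 2 + 1 + q ^- 2) *: (e1 * e2 * e1 ^+ 2) - e2 * e1 ^+ 3) 0
  | uq_serre_f21 : uq_rel
      (f2 ^+ 2 * f1 - (q ^+ 2 + q ^- 2) *: (f2 * f1 * f2) + f1 * f2 ^+ 2) 0
  | uq_serre_f12 : uq_rel
      (f1 ^+ 3 * f2 - (q ^+ 2 + 1 + q ^- 2) *: (f1 ^+ 2 * f2 * f1)
       + (q ^+ 2 + 1 + q ^- 2) *: (f1 * f2 * f1 ^+ 2) - f2 * f1 ^+ 3) 0.

Lemma uq_rel_counit (h : {rmorphism A -> F}) u v :
    (forall c x, h (c *: x) = c * h x) ->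
    (forall i, h (e i) = 0) -> (forall i, h (f i) = 0) ->
    (forall i, h (k i) = 1) -> (forall i, h (kV i) = 1) ->
  uq_rel u v -> h u = h v.
Proof.
move=> hZ he hf hk hkV.
case=> [i|i|i j|i j|i j|i j||||]; try case: ifP => _;
by rewrite ?exprS ?expr0 !(rmorphB, rmorphD, hZ, rmorphM, rmorph0, rmorph1,
  he, hf, hk, hkV) /= ?(mulr0, mul0r, mulr1, mul1r, subrr, addr0, subr0).
Qed.
End InAlgebra.

Lemma uq_rel_morph (A B : lalgType F) (h : {rmorphism A -> B})
    (e f k kV : 'I_2 -> A) :
    (forall c x, h (c *: x) = c *: h x) ->
    (forall u v, uq_rel e f k kV u v -> h u = h v) ->
  forall u v, uq_rel (h \o e) (h \o f) (h \o k) (h \o kV) u v -> u = v.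
Proof.
move=> hZ hr u v [i|i|i j|i j|i j|i j||||] /=.
- by have := hr _ _ (uq_kkV _ _ _ _ i); rewrite rmorphM rmorph1.
- by have := hr _ _ (uq_kVk _ _ _ _ i); rewrite rmorphM rmorph1.
- have := hr _ _ (uq_ef _ _ _ _ i j); case: ifP => _.
    by rewrite rmorphB !rmorphM hZ rmorphB.
  by rewrite rmorphB !rmorphM rmorph0.
- by have := hr _ _ (uq_kk _ _ _ _ i j); rewrite rmorphB !rmorphM rmorph0.
- by have := hr _ _ (uq_ke _ _ _ _ i j); rewrite hZ !rmorphM.
- by have := hr _ _ (uq_kf _ _ _ _ i j); rewrite hZ !rmorphM.
- by have := hr _ _ (uq_serre_e21 e f k kV);
    rewrite !(rmorphB, rmorphD, hZ, rmorphM, rmorphXn, rmorph0).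
- by have := hr _ _ (uq_serre_e12 e f k kV);
    rewrite !(rmorphB, rmorphD, hZ, rmorphM, rmorphXn, rmorph0).
- by have := hr _ _ (uq_serre_f21 e f k kV);
    rewrite !(rmorphB, rmorphD, hZ, rmorphM, rmorphXn, rmorph0).
- by have := hr _ _ (uq_serre_f12 e f k kV);
    rewrite !(rmorphB, rmorphD, hZ, rmorphM, rmorphXn, rmorph0).
Qed.
End Relations.

(* The free unital associative F-algebra on gen: finitely supported functions
   from words (elements of the free monoid) to F, with convolution. *)
Notation free_alg F := {malg F[{fmonom gen}]}.

Section Presentation.
Variables (F : fieldType) (q : F).

Definition word (g : gen) : free_alg F := << fmu g >>.

Definition free_rel : free_alg F -> free_alg F -> Prop :=
  uq_rel q (word \o gen_e) (word \o gen_f) (word \o gen_k) (word \o gen_kV).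

(* The two-sided ideal of the free algebra generated by the differences
   u - v of related elements. *)
Inductive uq_ideal_spec : free_alg F -> Prop :=
  | uq_ideal_rel a u v b : free_rel u v -> uq_ideal_spec (a * (u - v) * b)
  | uq_ideal_0 : uq_ideal_spec 0
  | uq_ideal_add x y :
      uq_ideal_spec x -> uq_ideal_spec y -> uq_ideal_spec (x + y).

Definition uq_ideal : {pred free_alg F} := fun x => `[< uq_ideal_spec x >].

Lemma uq_idealP x : reflect (uq_ideal_spec x) (x \in uq_ideal).
Proof. exact: asboolP. Qed.

Lemma uq_ideal_mull a x : x \in uq_ideal -> a * x \in uq_ideal.
Proof.
move=> /uq_idealP h; apply/uq_idealP; elim: h => [c u v b r||x' y _ hx _ hy].
- by rewrite !mulrA -[a * c * _ * b]mulrA mulrA; apply: uq_ideal_rel.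
- by rewrite mulr0; apply: uq_ideal_0.
- by rewrite mulrDr; apply: uq_ideal_add.
Qed.

Lemma uq_ideal_mulr a x : x \in uq_ideal -> x * a \in uq_ideal.
Proof.
move=> /uq_idealP h; apply/uq_idealP; elim: h => [c u v b r||x' y _ hx _ hy].
- by rewrite -mulrA; apply: uq_ideal_rel.
- by rewrite mul0r; apply: uq_ideal_0.
- by rewrite mulrDl; apply: uq_ideal_add.
Qed.

Lemma uq_ideal_zmod : zmod_closed uq_ideal.
Proof.
split; first by apply/uq_idealP/uq_ideal_0.
move=> x y /uq_idealP hx hy; apply/uq_idealP/uq_ideal_add => //.
by rewrite -mulN1r; apply/uq_idealP/uq_ideal_mull.
Qed.

HB.instance Definition _ :=
  GRing.isZmodClosed.Build (free_alg F) uq_ideal uq_ideal_zmod.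

(* The counit word |-> prod of the values e_i, f_i |-> 0, k_i^{+-1} |-> 1; it
   kills uq_ideal, whence 1 != 0 in the quotient. *)
Definition counit_gen (g : gen) : F :=
  match g with gen_e _ | gen_f _ => 0 | gen_k _ | gen_kV _ => 1 end.

Definition counit_word (m : {fmonom gen}) : F := \prod_(g <- m) counit_gen g.

Lemma counit_word_mmorphism : mmorphism counit_word.
Proof.
split=> [x y|]; rewrite /counit_word; first by rewrite fmM big_cat.
by rewrite fm1 big_nil.
Qed.
HB.instance Definition _ :=
  isMultiplicative.Build {fmonom gen} F counit_word counit_word_mmorphism.

Definition counit : free_alg F -> F := mmap idfun counit_word.
HB.instance Definition _ := GRing.RMorphism.on counit.
HB.instance Definition _ := GRing.Linear.on counit.

Lemma counitE g : counit (word g) = counit_gen g.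
Proof. by rewrite /counit mmapU mul1r /counit_word fmU big_seq1. Qed.

Lemma counitZ c u : counit (c *: u) = c * counit u.
Proof. by rewrite -mul_malgC rmorphM /= /counit mmapC. Qed.

Lemma counit_rel u v : free_rel u v -> counit u = counit v.
Proof.
by apply: uq_rel_counit => [|i|i|i|i]; [exact: counitZ|exact: counitE..].
Qed.

Lemma counit_ideal x : uq_ideal_spec x -> counit x = 0.
Proof.
elim=> [a u v b r||y z _ hy _ hz]; last 2 first.
- exact: rmorph0.
- by rewrite rmorphD /= hy hz addr0.
by rewrite !rmorphM rmorphB /= (counit_rel r) subrr mulr0 mul0r.
Qed.

Lemma free_scaleE (c : F) (x : free_alg F) : c *: x = c%:MP * x.
Proof. by rewrite mul_malgC. Qed.

Lemma free_scalar_comm (c : F) (x : free_alg F) : c%:MP * x = x * c%:MP.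
Proof.
rewrite malgM_def fgmulUg malgM_def fgmulgU.
by apply: eq_bigr => w _; rewrite mul1m mulm1 mulrC.
Qed.

Lemma free_scalerAr (c : F) (x y : free_alg F) : c *: (x * y) = x * (c *: y).
Proof.
by rewrite (free_scaleE c (x * y)) (free_scaleE c y) mulrA
  free_scalar_comm -mulrA.
Qed.

Definition Uq : Type := Quotient.quot uq_ideal.
HB.instance Definition _ := GRing.Zmodule.on Uq.
HB.instance Definition _ := EqQuotient.on Uq.

Definition Uq_pi (x : free_alg F) : Uq := \pi_Uq x.

Lemma Uq_ind (P : Uq -> Prop) : (forall x, P (Uq_pi x)) -> forall x, P x.
Proof. by move=> h x; rewrite -[x]reprK; apply: h. Qed.

Lemma Uq_eqP x y : reflect (Uq_pi x = Uq_pi y) (x - y \in uq_ideal).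
Proof. by apply: (iffP idP); rewrite (Quotient.idealrBE uq_ideal) => /eqP. Qed.

Definition Uq_one : Uq := Uq_pi 1.
Definition Uq_mul (x y : Uq) : Uq := Uq_pi (repr x * repr y).
Definition Uq_scale (c : F) (x : Uq) : Uq := Uq_pi (c *: repr x).

Lemma Uq_repr x : repr (Uq_pi x) - x \in uq_ideal.
Proof. by apply/Uq_eqP; rewrite /Uq_pi reprK. Qed.

Lemma Uq_piD x y : Uq_pi (x + y) = Uq_pi x + Uq_pi y.
Proof. exact: (Quotient.pi_add uq_ideal). Qed.

Lemma Uq_piM x y : Uq_pi (x * y) = Uq_mul (Uq_pi x) (Uq_pi y).
Proof.
apply/esym/Uq_eqP; set x' := repr _; set y' := repr _.
have -> : x' * y' - x * y = (x' - x) * y' + x * (y' - y).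
  by rewrite mulrBl mulrBr addrA subrK.
by apply: rpredD; [apply: uq_ideal_mulr|apply: uq_ideal_mull]; apply: Uq_repr.
Qed.

Lemma Uq_piZ c x : Uq_pi (c *: x) = Uq_scale c (Uq_pi x).
Proof.
apply/esym/Uq_eqP; rewrite -scalerBr free_scaleE.
exact/uq_ideal_mull/Uq_repr.
Qed.

Lemma Uq_mulA : associative Uq_mul.
Proof.
elim/Uq_ind=> x; elim/Uq_ind=> y; elim/Uq_ind=> z.
by rewrite -(Uq_piM y z) -(Uq_piM x y) -!Uq_piM;
  exact: (congr1 Uq_pi (mulrA x y z)).
Qed.

Lemma Uq_mul1r : left_id Uq_one Uq_mul.
Proof.
by elim/Uq_ind=> x; rewrite /Uq_one -Uq_piM; congr Uq_pi; apply: mul1r.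
Qed.

Lemma Uq_mulr1 : right_id Uq_one Uq_mul.
Proof.
by elim/Uq_ind=> x; rewrite /Uq_one -Uq_piM; congr Uq_pi; apply: mulr1.
Qed.

Lemma Uq_mulDl : left_distributive Uq_mul +%R.
Proof.
elim/Uq_ind=> x; elim/Uq_ind=> y; elim/Uq_ind=> z.
by rewrite -Uq_piD -!Uq_piM -Uq_piD; congr Uq_pi; apply: mulrDl.
Qed.

Lemma Uq_mulDr : right_distributive Uq_mul +%R.
Proof.
elim/Uq_ind=> x; elim/Uq_ind=> y; elim/Uq_ind=> z.
by rewrite -Uq_piD -!Uq_piM -Uq_piD; congr Uq_pi; apply: mulrDr.
Qed.

Lemma Uq_one_neq0 : Uq_one != 0.
Proof.
have <- : Uq_pi 0 = 0 by apply: (addrI (Uq_pi 0)); rewrite -Uq_piD !addr0.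
apply/eqP => /Uq_eqP; rewrite subr0 => /uq_idealP /counit_ideal /eqP.
by rewrite rmorph1 oner_eq0.
Qed.

HB.instance Definition _ := GRing.Zmodule_isNzRing.Build Uq
  Uq_mulA Uq_mul1r Uq_mulr1 Uq_mulDl Uq_mulDr Uq_one_neq0.

Lemma Uq_scalerA a b x : Uq_scale a (Uq_scale b x) = Uq_scale (a * b) x.
Proof.
elim/Uq_ind: x => x; rewrite -(Uq_piZ b) -!Uq_piZ.
exact: (congr1 Uq_pi (scalerA a b x)).
Qed.

Lemma Uq_scale1r : left_id 1 Uq_scale.
Proof.
by elim/Uq_ind=> x; rewrite -Uq_piZ; congr Uq_pi; apply: scale1r.
Qed.

Lemma Uq_scalerDr : right_distributive Uq_scale +%R.
Proof.
move=> c; elim/Uq_ind=> x; elim/Uq_ind=> y.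
by rewrite -Uq_piD -!Uq_piZ -Uq_piD; congr Uq_pi; apply: scalerDr.
Qed.

Lemma Uq_scalerDl x : {morph Uq_scale^~ x : a b / a + b}.
Proof.
move=> a b; elim/Uq_ind: x => x.
by rewrite -!Uq_piZ -Uq_piD; congr Uq_pi; apply: scalerDl.
Qed.

HB.instance Definition _ := GRing.Zmodule_isLmodule.Build F Uq
  Uq_scalerA Uq_scale1r Uq_scalerDr Uq_scalerDl.

Lemma Uq_scalerAl c (x y : Uq) : c *: (x * y) = c *: x * y.
Proof.
change (Uq_scale c (Uq_mul x y) = Uq_mul (Uq_scale c x) y).
elim/Uq_ind: x => x; elim/Uq_ind: y => y.
by rewrite -Uq_piM -!Uq_piZ -Uq_piM; congr Uq_pi; apply: scalerAl.
Qed.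

HB.instance Definition _ := GRing.Lmodule_isLalgebra.Build F Uq Uq_scalerAl.

Lemma Uq_scalerAr c (x y : Uq) : c *: (x * y) = x * (c *: y).
Proof.
change (Uq_scale c (Uq_mul x y) = Uq_mul x (Uq_scale c y)).
elim/Uq_ind: x => x; elim/Uq_ind: y => y.
by rewrite -Uq_piM -!Uq_piZ -Uq_piM; congr Uq_pi; apply: free_scalerAr.
Qed.

HB.instance Definition _ := GRing.Lalgebra_isAlgebra.Build F Uq Uq_scalerAr.

Lemma Uq_pi_zmod_morphism : zmod_morphism Uq_pi.
Proof. by move=> x y; apply: (addIr (Uq_pi y)); rewrite subrK -Uq_piD subrK. Qed.
HB.instance Definition _ :=
  GRing.isZmodMorphism.Build (free_alg F) Uq Uq_pi Uq_pi_zmod_morphism.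

Lemma Uq_pi_monoid_morphism : monoid_morphism Uq_pi.
Proof. by split; [exact: erefl|exact: Uq_piM]. Qed.
HB.instance Definition _ :=
  GRing.isMonoidMorphism.Build (free_alg F) Uq Uq_pi Uq_pi_monoid_morphism.

Lemma Uq_pi_rel u v : free_rel u v -> Uq_pi u = Uq_pi v.
Proof.
move=> r; apply/Uq_eqP/uq_idealP.
by rewrite -[_ - _]mul1r -[1 * _]mulr1; apply: uq_ideal_rel.
Qed.
End Presentation.

Section CentralElement.
Variables (F : fieldType) (q : F).

Definition Uq_e (i : 'I_2) : Uq q := Uq_pi q (word F (gen_e i)).
Definition Uq_f (i : 'I_2) : Uq q := Uq_pi q (word F (gen_f i)).
Definition Uq_k (i : 'I_2) : Uq q := Uq_pi q (word F (gen_k i)).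
Definition Uq_kV (i : 'I_2) : Uq q := Uq_pi q (word F (gen_kV i)).

Lemma Uq_rel u v : uq_rel q Uq_e Uq_f Uq_k Uq_kV u v -> u = v.
Proof.
exact: (@uq_rel_morph F q (free_alg F) (Uq q) (@Uq_pi F q)
  (word F \o gen_e) (word F \o gen_f) (word F \o gen_k) (word F \o gen_kV)
  (@Uq_piZ F q) (@Uq_pi_rel F q) u v).
Qed.

Definition Uq_kpow (i : 'I_2) (m : int) : Uq q :=
  match m with
  | Posz n => Uq_k i ^+ n
  | Negz n => Uq_kV i ^+ n.+1
  end.

(* k_(a,b) = k_1^a k_2^((a+b)/2); meaningful only when a + b is even, i.e. for
   (a, b) in the root lattice. *)
Definition Uq_kroot (a b : int) : Uq q :=
  Uq_kpow 0 a * Uq_kpow 1 ((a + b) %/ 2)%Z.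

Local Notation e1 := (Uq_e 0).
Local Notation e2 := (Uq_e 1).
Local Notation f1 := (Uq_f 0).
Local Notation f2 := (Uq_f 1).
Local Notation k_ := Uq_kroot.

Definition casimir : Uq q :=
  (q ^- 2 * (q - q^-1) ^+ 2) *:
    (((1 - q ^+ 2) *: (f1 * f2 * f1 * f2)
      + (q ^+ 4 - q ^- 2) *: (f2 * f1 ^+ 2 * f2)
      + (1 - q ^+ 2) *: (f2 * f1 * f2 * f1)
      + (1 - q ^+ 2) *: (f1 * f2 ^+ 2 * f1))
     * k_ 0 0
     * ((1 - q ^+ 2) *: (e1 * e2 * e1 * e2)
        + (q ^+ 4 - q ^- 2) *: (e2 * e1 ^+ 2 * e2)
        + (1 - q ^+ 2) *: (e2 * e1 * e2 * e1)
        + (1 - q ^+ 2) *: (e1 * e2 ^+ 2 * e1)))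
  + (q - q^-1) ^+ 4 *: (f1 * f1 * k_ 0 0 * e1 * e1)
  + (q - q^-1) ^+ 2 *:
    (((1 + q ^+ 2) *: (f1 * f2 * f1) - f2 * f1 * f1 - q ^+ 2 *: (f1 * f1 * f2))
     * k_ 0 2
     * ((1 + q ^+ 2) *: (e1 * e2 * e1) - e1 * e1 * e2
        - q ^+ 2 *: (e2 * e1 * e1)))
  + ((q - q^-1) ^+ 2 * (q + q^-1)) *:
    ((q ^+ 2 *: (f1 * f2) - f2 * f1) * k_ 1 1
     * (q ^+ 2 *: (e2 * e1) - e1 * e2))
  + ((q ^+ 2 - q ^- 2) ^+ 2 * q ^+ 4) *: (f2 * k_ 2 0 * e2)
  + (q ^- 4 * (q - q^-1) ^+ 2) *:
    (((1 + q ^+ 2) *: (f1 * f2 * f1) - f1 * f1 * f2 - q ^+ 2 *: (f2 * f1 * f1))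
     * k_ 0 (-2)
     * ((1 + q ^+ 2) *: (e1 * e2 * e1) - e2 * e1 * e1
        - q ^+ 2 *: (e1 * e1 * e2)))
  + (q ^- 4 * (q - q^-1) ^+ 2 * (q + q^-1)) *:
    ((q ^+ 2 *: (f2 * f1) - f1 * f2) * k_ (-1) (-1)
     * (q ^+ 2 *: (e1 * e2) - e2 * e1))
  + (q ^- 4 * (q ^+ 2 - q ^- 2) ^+ 2) *: (f2 * k_ (-2) 0 * e2)
  + ((q - q^-1) ^+ 2 * (q + q^-1)) *: (f1 * k_ (-1) 1 * e1)
  + ((q - q^-1) ^+ 2 * (q + q^-1)) *: (f1 * k_ 1 (-1) * e1)
  + q ^+ 6 *: k_ 2 2 + q ^- 6 *: k_ (-2) (-2) + q ^+ 2 *: k_ 2 (-2)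
  + q ^- 2 *: k_ (-2) 2 + k_ 0 0.
End CentralElement.

(* Main.v *)
(* The relations of U_q(sp_4), oriented so as to move every word towards a
   combination of words (f's)(k's)(e's) and to normalize the f-part and the
   e-part by the quantum Serre relations, form a terminating rewriting system.
   In the weights met in the commutators of the Casimir element C with the
   generators, it is confluent once the overlap of the two Serre relations has
   been resolved by one additional rule. So C is central because the normal
   form of C x - x C vanishes for each generator x, which is a finite
   computation with coefficients in Z[q, q^-1, 1 / (q^2 - q^-2)]. Only the
   soundness of the rewriting has to be proved, not its termination or
   confluence. *)
From HB Require Import structures.
Require Import Defs.
From mathcomp Require Import all_boot all_order all_algebra.
From mathcomp Require Import reals.
From mathcomp.real_closed Require Import complex.
From mathcomp Require Import ring.
From mathcomp.multinomials Require Import monalg.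

Set Implicit Arguments.
Unset Strict Implicit.
Unset Printing Implicit Defensive.

Import GRing.Theory.

Local Open Scope ring_scope.

(** * Formal scalars and noncommutative expressions *)

(* The index i of the generators is encoded by the boolean i == 1;
   [K i s] is k_i^-1 if s, and k_i otherwise. *)
Inductive letter : Type :=
  | E of bool
  | F of bool
  | K of bool & bool.

Definition eq_letter (x y : letter) : bool :=
  match x, y with
  | E i, E j | F i, F j => eqb i j
  | K i s, K j t => eqb i j && eqb s t
  | _, _ => false
  end.

Lemma eq_letterP : Equality.axiom eq_letter.
Proof. by do 2![case=> [[]|[]|[] []]]; constructor. Qed.

HB.instance Definition _ := hasDecEq.Build letter eq_letterP.

(* [(c, n, b)] stands for the scalar c q^n (q^2 - q^-2)^-b. *)
Definition coef : Type := int * int * nat.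
Definition scalar : Type := seq coef.
Definition term : Type := scalar * seq letter.
Definition expr : Type := seq term.

(** Like terms are merged but stay in the list when their coefficients cancel; [is_null_scalar]
    therefore tests the collected coefficients, not emptiness. *)
Fixpoint sinsert (a : coef) (s : scalar) : scalar :=
  if s is b :: s' then
    if (b.1.2 == a.1.2) && (b.2 == a.2) then (b.1.1 + a.1.1, b.1.2, b.2) :: s'
    else b :: sinsert a s'
  else [:: a].

Definition sadd (s t : scalar) : scalar := foldr sinsert t s.
Definition sopp (s : scalar) : scalar := [seq (- a.1.1, a.1.2, a.2) | a <- s].
Definition smul (s t : scalar) : scalar :=
  sadd [seq (a.1.1 * b.1.1, a.1.2 + b.1.2, (a.2 + b.2)%N) | a <- s, b <- t]
    [::].
Definition spow (n : int) : scalar := [:: (1, n, 0%N)].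
Definition sexp (s : scalar) (n : nat) : scalar := iter n (smul s) (spow 0).
Definition is_null_scalar (s : scalar) : bool :=
  all (fun a : coef => a.1.1 == 0) (sadd s [::]).

(* Multiplies by q^2 - q^-2, which clears all denominators in the commutators
   with C, where b <= 1, and so allows comparing Laurent polynomials. *)
Definition clear_coef (a : coef) : scalar :=
  let: (c, n, b) := a in
  if b is b'.+1 then [:: (c, n, b')]
  else [:: (c, n + 2, 0%N); (- c, n - 2, 0%N)].

Definition eopp (p : expr) : expr := [seq (sopp t.1, t.2) | t <- p].
Definition emul (p r : expr) : expr :=
  [seq (smul s.1 t.1, s.2 ++ t.2) | s <- p, t <- r].
Definition emonom (s : scalar) (w : seq letter) : expr := [:: (s, w)].
Definition eword (w : seq letter) : expr := emonom (spow 0) w.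
Definition eexp (p : expr) (n : nat) : expr := iter n (emul p) (eword [::]).

Arguments emul : simpl never.
Arguments eopp : simpl never.
Arguments emonom : simpl never.

Fixpoint insert (t : term) (p : expr) : expr :=
  if p is s :: p' then
    if s.2 == t.2 then (sadd t.1 s.1, s.2) :: p' else s :: insert t p'
  else [:: t].

Definition is_null (p : expr) : bool :=
  all (fun t : term => is_null_scalar (flatten (map clear_coef t.1)))
    (foldr insert [::] p).

(** * The rewriting rules *)

Definition cartan (i j : bool) : int :=
  if i then (if j then 4 else -2) else (if j then -2 else 2).

(** The target order is f's, k's, e's, with k_1 before k_2 and inverse pairs cancelled. For the pair
    e_1, f_1 the scalar 1 / (q - q^-1) is written (q + q^-1) / (q^2 - q^-2), so that only one kind
    of denominator occurs. *)
Definition pair_rule (x y : letter) : option expr :=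
  match x, y with
  | E i, F j => Some (
      (if eqb i j then
         let d := if i then [:: (1, 0, 1%N)] else [:: (1, 1, 1%N); (1, -1, 1%N)]
         in emonom d [:: K i false] ++ eopp (emonom d [:: K i true])
       else [::]) ++ eword [:: y; x])
  | E j, K i s =>
      Some (emonom (spow (if s then cartan i j else - cartan i j)) [:: y; x])
  | K i s, F j =>
      Some (emonom (spow (if s then cartan i j else - cartan i j)) [:: y; x])
  | K i s, K j t =>
      if eqb i j then if eqb s t then None else Some (eword [::])
      else if i then Some (eword [:: y; x]) else None
  | _, _ => None
  end.

Definition qint2 : scalar := [:: (1, 2, 0%N); (1, -2, 0%N)].
Definition qint3 : scalar := [:: (1, 2, 0%N); (1, 0, 0%N); (1, -2, 0%N)].

Definition serre21 (x : bool -> letter) : expr :=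
  let a := x false in let b := x true in
  eword [:: b; b; a] ++ eopp (emonom qint2 [:: b; a; b]) ++ eword [:: a; b; b].
Definition serre12 (x : bool -> letter) : expr :=
  let a := x false in let b := x true in
  eword [:: a; a; a; b] ++ eopp (emonom qint3 [:: a; a; b; a])
  ++ emonom qint3 [:: a; b; a; a] ++ eopp (eword [:: b; a; a; a]).

(* The S-polynomial of the overlap a a a b b of the two Serre relations. *)
Definition serre_overlap (x : bool -> letter) : expr :=
  let a := eword [:: x false] in let b := eword [:: x true] in
  emul (emul a a) (serre21 x) ++ eopp (emul (serre12 x) b)
  ++ eopp (emul b (serre12 x)) ++ eopp (emul a (emul (serre21 x) a))
  ++ emul (serre21 x) (emul a a).

(* The last rule is [serre_overlap] solved for its leading word. *)
Definition serre_rules (x : bool -> letter) : seq (seq letter * expr) :=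
  let a := x false in let b := x true in
  [:: ([:: a; b; b], emonom qint2 [:: b; a; b] ++ eopp (eword [:: b; b; a]));
      ([:: a; a; a; b],
       emonom qint3 [:: a; a; b; a] ++ eopp (emonom qint3 [:: a; b; a; a])
       ++ eword [:: b; a; a; a]);
      ([:: a; a; b; a; b],
       emonom qint3 [:: a; b; a; a; b] ++ eopp (emonom qint3 [:: b; a; a; b; a])
       ++ emonom (sadd qint2 qint3) [:: b; a; b; a; a]
       ++ eopp (emonom qint2 [:: a; b; a; b; a])
       ++ eopp (emonom [:: (2, 0, 0%N)] [:: b; b; a; a; a]))].

Definition rules : seq (seq letter * expr) := serre_rules E ++ serre_rules F.

(** * Normalization and the commutation test *)

Fixpoint head_rule (rs : seq (seq letter * expr)) (w : seq letter) :
    option expr :=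
  if rs is r :: rs' then
    if prefix r.1 w then Some (emul r.2 (eword (drop (size r.1) w)))
    else head_rule rs' w
  else if w is [:: x, y & w'] then
    omap (fun p => emul p (eword w')) (pair_rule x y)
  else None.

Fixpoint step (w : seq letter) : option expr :=
  if head_rule rules w is Some p then Some p
  else if w is x :: w' then omap (emul (eword [:: x])) (step w') else None.

(** The fuel [n] makes the recursion structural. A term met when the fuel is exhausted is kept
    unreduced, so the value is preserved for every [n]; the accumulator collects like words as they
    are produced. *)
Fixpoint normalize (n : nat) (t : term) (acc : expr) : expr :=
  if n is n'.+1 then
    if step t.2 is Some p then
      foldr (fun s => normalize n' (smul t.1 s.1, s.2)) acc p
    else insert t acc
  else insert t acc.

Definition commute_check (p r : expr) : bool :=
  is_null (foldr (normalize 100) [::] (emul p r ++ eopp (emul r p))).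

(** * Values of expressions in an algebra satisfying the relations *)

Section Denotation.
Variables (R : fieldType) (q : R) (A : algType R) (e f k kV : 'I_2 -> A).
Hypotheses (q_neq0 : q != 0) (qq_neq0 : q ^+ 2 - q ^- 2 != 0).
Hypothesis rel_eq : forall u v, uq_rel q e f k kV u v -> u = v.

Definition coef_val (a : coef) : R :=
  a.1.1%:~R * q ^ a.1.2 * (q ^+ 2 - q ^- 2) ^- a.2.
Definition scalar_val (s : scalar) : R := \sum_(a <- s) coef_val a.
Definition gen_index (i : bool) : 'I_2 := if i then 1 else 0.
Definition letter_val (x : letter) : A :=
  match x with
  | E i => e (gen_index i)
  | F i => f (gen_index i)
  | K i s => (if s then kV else k) (gen_index i)
  end.
Definition word_val (w : seq letter) : A := \prod_(x <- w) letter_val x.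
Definition term_val (t : term) : A := scalar_val t.1 *: word_val t.2.
Definition value (p : expr) : A := \sum_(t <- p) term_val t.

Lemma coef_val_eq c n : coef_val (c, n, 0%N) = c%:~R * q ^ n.
Proof. by rewrite /coef_val expr0 invr1 mulr1. Qed.

Lemma scalar_val_cons a s : scalar_val (a :: s) = coef_val a + scalar_val s.
Proof. exact: big_cons. Qed.

Lemma scalar_val_nil : scalar_val [::] = 0.
Proof. exact: big_nil. Qed.

Lemma scalar_val_insert a s :
  scalar_val (sinsert a s) = coef_val a + scalar_val s.
Proof.
elim: s => [|b s IHs] /=; first by rewrite scalar_val_cons.
case: ifP => [/andP[/eqP e1 /eqP e2]|_]; last first.
  by rewrite !scalar_val_cons IHs addrCA.
rewrite !scalar_val_cons addrA; congr (_ + _).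
by rewrite /coef_val /= -e1 -e2 -!mulrDl -intrD addrC.
Qed.

Lemma scalar_valD s t : scalar_val (sadd s t) = scalar_val s + scalar_val t.
Proof.
elim: s => [|a s IHs] /=; first by rewrite scalar_val_nil add0r.
by rewrite scalar_val_insert scalar_val_cons IHs addrA.
Qed.

Lemma scalar_valN s : scalar_val (sopp s) = - scalar_val s.
Proof.
rewrite /scalar_val big_map -sumrN; apply: eq_bigr => a _.
by rewrite /coef_val /= intrN !mulNr.
Qed.

Lemma scalar_valM s t : scalar_val (smul s t) = scalar_val s * scalar_val t.
Proof.
rewrite scalar_valD scalar_val_nil addr0 /scalar_val big_allpairs_dep mulr_suml.
apply: eq_bigr => a _; rewrite mulr_sumr; apply: eq_bigr => b _.
by rewrite /coef_val /= intrM expfzDr // exprD invfM; ring.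
Qed.

Lemma scalar_val_pow n : scalar_val (spow n) = q ^ n.
Proof. by rewrite /scalar_val big_seq1 coef_val_eq mul1r. Qed.

Lemma scalar_valX s n : scalar_val (sexp s n) = scalar_val s ^+ n.
Proof.
elim: n => [|n IHn]; first exact: scalar_val_pow.
by rewrite /sexp iterS scalar_valM IHn exprS.
Qed.

Lemma scalar_val_null s : is_null_scalar s -> scalar_val s = 0.
Proof.
rewrite -[RHS]subr0 -scalar_val_nil /is_null_scalar.
have -> : scalar_val s = scalar_val (sadd s [::]).
  by rewrite scalar_valD scalar_val_nil addr0.
rewrite scalar_val_nil subr0.
elim: (sadd _ _) => [_|a r IHr /= /andP[/eqP a0 /IHr r0]].
  exact: scalar_val_nil.
by rewrite scalar_val_cons r0 addr0 /coef_val a0 !mul0r.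
Qed.

Lemma scalar_val_clear s :
  scalar_val (flatten (map clear_coef s)) = (q ^+ 2 - q ^- 2) * scalar_val s.
Proof.
elim: s => [|[[c n] [|b]] s IHs] /=; rewrite ?scalar_val_nil ?mulr0 //.
  rewrite !scalar_val_cons IHs addrA mulrDr !coef_val_eq; congr (_ + _).
  by rewrite intrN !expfzDr // -exprnP -exprnN; ring.
rewrite !scalar_val_cons IHs mulrDr; congr (_ + _); rewrite /coef_val /=.
move: qq_neq0; generalize (q ^+ 2 - q ^- 2) => d d_neq0.
by rewrite [RHS]mulrCA (exprS _ b) invfM mulVKf.
Qed.

Lemma word_val_nil : word_val [::] = 1.
Proof. exact: big_nil. Qed.

Lemma word_val_cons x w : word_val (x :: w) = letter_val x * word_val w.
Proof. exact: big_cons. Qed.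

Lemma word_val_cat w v : word_val (w ++ v) = word_val w * word_val v.
Proof. exact: big_cat. Qed.

Lemma value_nil : value [::] = 0.
Proof. exact: big_nil. Qed.

Lemma value_cons t p : value (t :: p) = term_val t + value p.
Proof. exact: big_cons. Qed.

Lemma value_cat p r : value (p ++ r) = value p + value r.
Proof. exact: big_cat. Qed.

Lemma value_opp p : value (eopp p) = - value p.
Proof.
rewrite /value big_map -sumrN; apply: eq_bigr => t _.
by rewrite -scaleNr -scalar_valN.
Qed.

Lemma value_mul p r : value (emul p r) = value p * value r.
Proof.
rewrite /value big_allpairs_dep mulr_suml; apply: eq_bigr => s _.
rewrite mulr_sumr; apply: eq_bigr => t _.
by rewrite /term_val scalar_valM word_val_cat -scalerAl -scalerAr scalerA.
Qed.

Lemma value_monom s w : value (emonom s w) = scalar_val s *: word_val w.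
Proof. by rewrite /value big_seq1. Qed.

Lemma value_word w : value (eword w) = word_val w.
Proof. by rewrite value_monom scalar_val_pow scale1r. Qed.

Lemma value_exp p n : value (eexp p n) = value p ^+ n.
Proof.
elim: n => [|n IHn]; first by rewrite value_word word_val_nil.
by rewrite /eexp iterS value_mul IHn exprS.
Qed.

Lemma value_insert t p : value (insert t p) = term_val t + value p.
Proof.
elim: p => [|s p IHp] /=; first by rewrite value_cons.
case: ifP => [/eqP st|_]; last by rewrite !value_cons IHp addrCA.
rewrite !value_cons addrA; congr (_ + _).
by rewrite /term_val scalar_valD scalerDl st.
Qed.

(** Clearing multiplies each coefficient by q^2 - q^-2, which is nonzero in a field, so a
    coefficient that vanishes after clearing vanished before. *)
Lemma value_null p : is_null p -> value p = 0.
Proof.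
have -> : value p = value (foldr insert [::] p).
  by elim: p => //= t p IHp; rewrite value_insert value_cons IHp.
rewrite /is_null; elim: (foldr _ _ _) => [_|t r IHr /= /andP[t0 /IHr r0]].
  exact: value_nil.
move: t0 => /scalar_val_null/eqP.
rewrite scalar_val_clear mulf_eq0 (negPf qq_neq0) /= => /eqP t0.
by rewrite value_cons r0 addr0 /term_val t0 scale0r.
Qed.

Lemma scalar_val_qint2 : scalar_val qint2 = q ^+ 2 + q ^- 2.
Proof.
by rewrite !scalar_val_cons scalar_val_nil !coef_val_eq addr0 !mul1r.
Qed.

Lemma scalar_val_qint3 : scalar_val qint3 = q ^+ 2 + 1 + q ^- 2.
Proof.
by rewrite !scalar_val_cons scalar_val_nil !coef_val_eq addr0 !mul1r addrA.
Qed.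

Definition value_simp := (scalar_val_qint2, scalar_val_qint3, scalar_val_pow,
  value_cat, value_opp, value_word, value_monom, word_val_cons, word_val_nil,
  mulr1).

(** * Soundness of the rewriting rules *)

Lemma kkV i : k i * kV i = 1.
Proof. exact: (rel_eq (uq_kkV _ _ _ _ _ i)). Qed.

Lemma kVk i : kV i * k i = 1.
Proof. exact: (rel_eq (uq_kVk _ _ _ _ _ i)). Qed.

(** Multiply the hypothesis by [kV i] on both sides. *)
Lemma kV_qcomm i n (x : A) : k i * x = q ^ n *: (x * k i) ->
  kV i * x = q ^ (- n) *: (x * kV i).
Proof.
move=> kx; have: kV i * (k i * x) * kV i = q ^ n *: (kV i * x).
  by rewrite kx -scalerAr -scalerAl -!mulrA kkV mulr1.
rewrite mulrA kVk mul1r => ->.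
by rewrite scalerA -expfzDr // addNr expr0z scale1r.
Qed.

Lemma qcomm_sym n (x y : A) :
  x * y = q ^ n *: (y * x) -> y * x = q ^ (- n) *: (x * y).
Proof. by move=> ->; rewrite scalerA -expfzDr // addNr expr0z scale1r. Qed.

Lemma k_comm i j : k i * k j = k j * k i.
Proof. by apply/eqP; rewrite -subr_eq0 (rel_eq (uq_kk _ _ _ _ _ i j)). Qed.

Lemma kV_k_comm i j : kV i * k j = k j * kV i.
Proof.
(* Plain commutation is q-commutation with exponent 0. *)
by have := @kV_qcomm i 0 (k j); rewrite !scale1r; apply; apply: k_comm.
Qed.

Lemma kV_comm i j : kV i * kV j = kV j * kV i.
Proof.
by have := @kV_qcomm i 0 (kV j); rewrite !scale1r; apply; rewrite kV_k_comm.
Qed.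

Lemma cartanE i j :
  inner (simple_root (gen_index i)) (simple_root (gen_index j)) = cartan i j.
Proof. by case: i j => [] []. Qed.

Lemma ke_qcomm i j :
  k (gen_index i) * e (gen_index j) =
  q ^ cartan i j *: (e (gen_index j) * k (gen_index i)).
Proof. by rewrite -cartanE (rel_eq (uq_ke _ _ _ _ _ _ _)). Qed.

Lemma kf_qcomm i j :
  k (gen_index i) * f (gen_index j) =
  q ^ (- cartan i j) *: (f (gen_index j) * k (gen_index i)).
Proof. by rewrite -cartanE (rel_eq (uq_kf _ _ _ _ _ _ _)). Qed.

Lemma ef_comm i j : e i * f j = f j * e i +
  (if i == j then (qi q i - (qi q i)^-1)^-1 *: (k i - kV i) else 0).
Proof. by rewrite -(rel_eq (uq_ef _ _ _ _ _ i j)) addrC subrK. Qed.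

Lemma index_eq i j : (gen_index i == gen_index j) = eqb i j.
Proof. by case: i j => [] []. Qed.

Lemma gen_index_onto i : exists b, i = gen_index b.
Proof.
by case: i => [[|[|]]] // lt_i2; [exists false | exists true]; apply: val_inj.
Qed.

(** Since q^2 - q^-2 = (q - q^-1)(q + q^-1) is nonzero, q + q^-1 is invertible and cancels from (q +
    q^-1) / (q^2 - q^-2). *)
Lemma scalar_val_qnum i :
  scalar_val (if i then [:: (1, 0, 1%N)] else [:: (1, 1, 1%N); (1, -1, 1%N)]) =
  (qi q (gen_index i) - (qi q (gen_index i))^-1)^-1.
Proof.
rewrite /qi; case: i; rewrite !scalar_val_cons scalar_val_nil addr0 /coef_val.
  by rewrite !mul1r expr1.
have qq : q ^+ 2 - q ^- 2 = (q - q^-1) * (q + q^-1).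
  by rewrite -exprVn subr_sqr.
have s_neq0 : q + q^-1 != 0.
  by apply: contraNneq qq_neq0 => s0; rewrite qq s0 mulr0.
by rewrite /= !mul1r expr1 -mulrDl qq invfM mulrCA divff // mulr1.
Qed.

Lemma pair_ruleP x y p : pair_rule x y = Some p ->
  letter_val x * letter_val y = value p.
Proof.
case: x y => [i|i|i s] [j|j|j t] //.
- move=> /Some_inj <-; rewrite ef_comm index_eq addrC value_cat !value_simp.
  congr (_ + _); case: ifP => _; last by rewrite value_nil.
  by rewrite !value_simp scalar_val_qnum scalerBr.
- case=> <-; rewrite !value_simp /=; case: t; last exact/qcomm_sym/ke_qcomm.
  (* For k_i^-1 the exponent is negated twice, once by [kV_qcomm] and once by [qcomm_sym]. *)
  by rewrite -[X in q ^ X]opprK; apply/qcomm_sym/kV_qcomm/ke_qcomm.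
- case=> <-; rewrite !value_simp /=; case: s; last exact/kf_qcomm.
  by rewrite -[X in q ^ X]opprK; apply/kV_qcomm/kf_qcomm.
- move=> /=; case: ifP => [/eqbP <-|_].
    by case: s t => [] [] //= [<-]; rewrite !value_simp ?kkV ?kVk.
  case: i => //= -[<-]; rewrite !value_simp /=.
  by case: s t => [] []; rewrite (k_comm, kV_comm, kV_k_comm).
Qed.

(** The e's and the f's obey the same Serre relations, so both are treated at once through the
    letter family [x]. *)
Definition serre_pair (x : bool -> letter) : Prop :=
  value (serre21 x) = 0 /\ value (serre12 x) = 0.

Lemma serre_pair_e : serre_pair E.
Proof.
split.
  rewrite -(rel_eq (uq_serre_e21 _ _ _ _ _)) /serre21 !value_simp.
  by rewrite expr2 addrA !mulrA.
rewrite -(rel_eq (uq_serre_e12 _ _ _ _ _)) /serre12 !value_simp.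
by rewrite !exprS !expr0 !mulr1 !addrA !mulrA.
Qed.

Lemma serre_pair_f : serre_pair F.
Proof.
split.
  rewrite -(rel_eq (uq_serre_f21 _ _ _ _ _)) /serre21 !value_simp.
  by rewrite expr2 addrA !mulrA.
rewrite -(rel_eq (uq_serre_f12 _ _ _ _ _)) /serre12 !value_simp.
by rewrite !exprS !expr0 !mulr1 !addrA !mulrA.
Qed.

(** The test checks p = r + s as a formal identity, by collecting like words without rewriting; the
    relations of the algebra enter only through [s]. *)
Lemma value_eq_mod p r s : value s = 0 -> is_null (p ++ eopp (r ++ s)) ->
  value p = value r.
Proof.
move=> s0 /value_null/eqP.
by rewrite value_cat value_opp value_cat s0 addr0 subr_eq0 => /eqP.
Qed.

(** Each summand of the overlap has a Serre relation as a factor. *)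
Lemma value_serre_overlap x : serre_pair x -> value (serre_overlap x) = 0.
Proof.
move=> [s21 s12].
by rewrite !(s21, s12, value_cat, value_opp, value_mul, mulr0, mul0r, oppr0,
  addr0).
Qed.

Lemma serre_rulesP x : x = E \/ x = F ->
  {in serre_rules x, forall r, word_val r.1 = value r.2}.
Proof.
move=> xP; have sx : serre_pair x.
  by case: xP => ->; [apply: serre_pair_e | apply: serre_pair_f].
have [s21 s12] := sx; have s112 := value_serre_overlap sx.
move=> r; rewrite !inE => /or3P[] /eqP-> {r}; rewrite -value_word.
- by apply: (value_eq_mod s21); case: xP => ->; vm_compute.
- by apply: (value_eq_mod s12); case: xP => ->; vm_compute.
(* The word a a b a b occurs in the overlap with coefficient [qint3] - [qint2] = 1, so solving for
   it needs no division. *)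
- by apply: (value_eq_mod s112); case: xP => ->; vm_compute.
Qed.

Lemma rulesP : {in rules, forall r, word_val r.1 = value r.2}.
Proof.
by move=> r; rewrite mem_cat => /orP[]; apply: serre_rulesP; [left | right].
Qed.

(** * Soundness of normalization *)

Lemma head_ruleP rs w p : {in rs, forall r, word_val r.1 = value r.2} ->
  head_rule rs w = Some p -> word_val w = value p.
Proof.
elim: rs => [|r rs IHrs] rsP /=.
  case: w => [|x [|y w]] //; case xy: (pair_rule x y) => [p'|] //= [<-].
  by rewrite value_mul -(pair_ruleP xy) value_word !word_val_cons mulrA.
case: ifP => [/prefixP[v ->] | _].
  move=> /Some_inj <-; rewrite drop_size_cat // value_mul value_word.
  by rewrite -rsP ?mem_head // word_val_cat.
by apply: IHrs => s sP; apply: rsP; rewrite inE sP orbT.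
Qed.

Lemma stepP w p : step w = Some p -> word_val w = value p.
Proof.
elim: w p => [|x w IHw] p; rewrite /step -/step.
  by case E: head_rule => [p'|] // [<-]; apply: head_ruleP E; apply: rulesP.
case E: head_rule => [p'|].
  by case=> <-; apply: head_ruleP E; apply: rulesP.
case: (step w) IHw => [r|] //= IHw [<-].
by rewrite value_mul value_word -IHw // !word_val_cons word_val_nil mulr1.
Qed.

Lemma normalizeP n t acc : value (normalize n t acc) = term_val t + value acc.
Proof.
elim: n t acc => [|n IHn] t acc /=; first exact: value_insert.
case E: step => [p|]; last exact: value_insert.
rewrite {1}/term_val (stepP E) {E}.
elim: p => [|s p IHp] /=; first by rewrite value_nil scaler0 add0r.
rewrite IHn IHp value_cons scalerDr addrA; congr (_ + _ + _).
by rewrite /term_val /= scalar_valM scalerA.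
Qed.

Lemma value_normalize n p : value (foldr (normalize n) [::] p) = value p.
Proof. by elim: p => //= t p IHp; rewrite normalizeP IHp value_cons. Qed.

Lemma commute_checkP p r : commute_check p r ->
  value p * value r = value r * value p.
Proof.
move=> /value_null/eqP; rewrite value_normalize.
by rewrite value_cat value_opp !value_mul subr_eq0 => /eqP.
Qed.

End Denotation.

(** * The Casimir element commutes with the generators *)

Section Casimir.
Variables (R : fieldType) (q : R).
Hypotheses (q_neq0 : q != 0) (qq_neq0 : q ^+ 2 - q ^- 2 != 0).

Local Notation Uq_value := (value q (Uq_e q) (Uq_f q) (Uq_k q) (Uq_kV q)).

(** As a relation, this lets [p] remain an existential variable that the syntax-directed lemmas
    below fill in from the shape of [x]. *)
Definition denotes (p : expr) (x : Uq q) : Prop := Uq_value p = x.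
Definition denotes_scalar (s : scalar) (c : R) : Prop := scalar_val q s = c.

Lemma denotes_add p r x y :
  denotes p x -> denotes r y -> denotes (p ++ r) (x + y).
Proof. by move=> <- <-; apply: value_cat. Qed.

Lemma denotes_opp p x : denotes p x -> denotes (eopp p) (- x).
Proof. by move=> <-; apply: value_opp. Qed.

Lemma denotes_mul p r x y :
  denotes p x -> denotes r y -> denotes (emul p r) (x * y).
Proof. by move=> <- <-; apply: value_mul. Qed.

Lemma denotes_exp p x n : denotes p x -> denotes (eexp p n) (x ^+ n).
Proof. by move=> <-; apply: value_exp. Qed.

Lemma denotes_scale s p c x : denotes_scalar s c -> denotes p x ->
  denotes (emul (emonom s [::]) p) (c *: x).
Proof.
move=> <- <-.
by rewrite /denotes value_mul // value_monom word_val_nil mulr_algl.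
Qed.

Lemma denotes_letter x : denotes (eword [:: x])
  (letter_val (Uq_e q) (Uq_f q) (Uq_k q) (Uq_kV q) x).
Proof. by rewrite /denotes value_word word_val_cons word_val_nil mulr1. Qed.

(** [Negz n] is -(n+1) with absolute value [n.+1], which is the exponent of [Uq_kV] in [Uq_kpow]. *)
Lemma denotes_kpow i m : denotes
  (eexp (eword [:: K i (if m is Posz _ then false else true)]) `|m|)
  (Uq_kpow q (gen_index i) m).
Proof. by case: m => n; apply/denotes_exp/denotes_letter. Qed.

Lemma scalar_add s t a b : denotes_scalar s a -> denotes_scalar t b ->
  denotes_scalar (sadd s t) (a + b).
Proof. by move=> <- <-; apply: scalar_valD. Qed.

Lemma scalar_opp s a : denotes_scalar s a -> denotes_scalar (sopp s) (- a).
Proof. by move=> <-; apply: scalar_valN. Qed.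

Lemma scalar_mul s t a b : denotes_scalar s a -> denotes_scalar t b ->
  denotes_scalar (smul s t) (a * b).
Proof. by move=> <- <-; apply: scalar_valM. Qed.

Lemma scalar_exp s a n :
  denotes_scalar s a -> denotes_scalar (sexp s n) (a ^+ n).
Proof. by move=> <-; apply: scalar_valX. Qed.

Lemma scalar_pow n : denotes_scalar (spow n) (q ^ n).
Proof. exact: scalar_val_pow. Qed.

Lemma scalar_expV n : denotes_scalar (spow (- n%:Z)) (q ^- n).
Proof. by rewrite exprnN; apply: scalar_pow. Qed.

Lemma denotes_comm p r x y :
  denotes p x -> denotes r y -> commute_check p r -> x * y = y * x.
Proof. by move=> <- <-; apply/commute_checkP/Uq_rel. Qed.

Lemma casimir_letter_comm x :
  let y := letter_val (Uq_e q) (Uq_f q) (Uq_k q) (Uq_kV q) x in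
  casimir q * y = y * casimir q.
Proof.
(* The expression for [casimir] is left open here and then synthesized by recursion on the defining
   formula. *)
move=> y; eapply denotes_comm; [|exact: denotes_letter|].
  rewrite /casimir /Uq_kroot.
  repeat lazymatch goal with
  | |- denotes _ (_ + _) => eapply denotes_add
  | |- denotes _ (- _) => eapply denotes_opp
  | |- denotes _ (_ * _) => eapply denotes_mul
  | |- denotes _ (_ *: _) => eapply denotes_scale
  | |- denotes _ (_ ^+ _) => eapply denotes_exp
  | |- denotes _ (Uq_e _ 0) => exact (denotes_letter (E false))
  | |- denotes _ (Uq_e _ 1) => exact (denotes_letter (E true))
  | |- denotes _ (Uq_f _ 0) => exact (denotes_letter (F false))
  | |- denotes _ (Uq_f _ 1) => exact (denotes_letter (F true))
  | |- denotes _ (Uq_kpow _ 0 _) => exact (denotes_kpow false _)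
  | |- denotes _ (Uq_kpow _ 1 _) => exact (denotes_kpow true _)
  | |- denotes_scalar _ (_ + _) => eapply scalar_add
  | |- denotes_scalar _ (- _) => eapply scalar_opp
  | |- denotes_scalar _ (_ * _) => eapply scalar_mul
  | |- denotes_scalar _ (_ ^+ _) => eapply scalar_exp
  | |- denotes_scalar _ 1 => exact (scalar_pow 0)
  | |- denotes_scalar _ q => exact (scalar_pow 1)
  | |- denotes_scalar _ (q^-1) => exact (scalar_expV 1)
  | |- denotes_scalar _ (q ^- _) => exact (scalar_expV _)
  end.
(* One closed computation for each of the eight letters e_i, f_i, k_i, k_i^-1. *)
by case: x {y} => [[]|[]|[] []]; vm_compute.
Qed.

End Casimir.

(** * From the generators to the whole algebra *)

Lemma free_alg_ind (R : fieldType) (P : free_alg R -> Prop) :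
    P 0 -> P 1 -> (forall x y, P x -> P y -> P (x + y)) ->
    (forall a x, P x -> P (a *: x)) ->
    (forall g x, P x -> P (word R g * x)) ->
  forall x, P x.
Proof.
move=> P0 P1 PD PZ PM x; rewrite [x]monalgE; elim/big_ind: _ => // m _.
have -> : << x@_m *g m >> = x@_m *: << m >> :> free_alg R.
  by rewrite -mul_malgC malgM_def fgmulUU mulr1 mul1m.
(* A monomial is split into generators by induction on the list underlying the free monoid. *)
apply: PZ; case: m => s; elim: s => [|g s IHs].
  suff -> : FMonom [::] = mone :> {fmonom gen} by [].
  by apply: val_inj; rewrite /= fm1.
suff -> : << FMonom (g :: s) >> = word R g * << FMonom s >> :> free_alg R.
  exact: PM.
rewrite malgM_def fgmulUU mulr1; congr << _ >>.
by apply: val_inj; rewrite /= fmM fmU.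
Qed.

(** The elements commuting with [c] form a subalgebra, and the classes of the generators generate
    [Uq q]. *)
Lemma Uq_central (R : fieldType) (q : R) (c : Uq q) :
    (forall g, c * Uq_pi q (word R g) = Uq_pi q (word R g) * c) ->
  forall x, c * x = x * c.
Proof.
move=> cg; elim/Uq_ind; elim/free_alg_ind => [||x y cx cy|a x cx|g x cx].
- by rewrite raddf0 mulr0 mul0r.
- by rewrite rmorph1 mulr1 mul1r.
- by rewrite Uq_piD mulrDr mulrDl cx cy.
- by rewrite Uq_piZ -Uq_scalerAr -Uq_scalerAl cx.
- by rewrite rmorphM; apply: commrM (cg g) cx.
Qed.

Theorem theorem1 (R : realType) (q : complex R) (q_neq0 : q != 0)
    (q_not_root_of_unity : forall n : nat, (0 < n)%N -> q ^+ n != 1) :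
  forall x : Uq q, casimir q * x = x * casimir q.
Proof.
have qq_neq0 : q ^+ 2 - q ^- 2 != 0.
  (* If q^2 = q^-2, then q^4 = 1, and q would be a root of unity. *)
  apply: contraNneq (q_not_root_of_unity 4 isT) => /eqP.
  rewrite subr_eq0 => /eqP qq.
  by rewrite (exprD _ 2 2) {1}qq mulVf // expf_neq0.
have comm := casimir_letter_comm q_neq0 qq_neq0.
apply: Uq_central => -[] i; have [b ->] := gen_index_onto i.
- exact: (comm (E b)).
- exact: (comm (F b)).
- exact: (comm (K b false)).
- exact: (comm (K b true)).
Qed.
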